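(* Let $F\subseteq\mathbb{R}^n$, $f\colon\mathbb{R}^n\to\mathbb{R}$, let $(\mathcal{C},\mathcal{D},g,z,\mathcal{T},\epsilon)$ be an $(F,f)$-valid configuration, and let $g'\colon\mathbb{R}^n\to\mathbb{R}$. If $\bigcap\mathcal{C}\subseteq\{x\in\mathbb{R}^n: g'(x)=g(x)\}$, then $(\mathcal{C},\mathcal{D},g',z,\mathcal{T},\epsilon)$ is also $(F,f)$-valid.
   Context: Constraints are arbitrary subsets of $\mathbb{R}^n$. For $\mathcal{C}\subseteq\mathcal{P}(\mathbb{R}^n)$ (power set) write $\bigcap\mathcal{C}=\bigcap_{C\in\mathcal{C}}C$, with $\bigcap\emptyset=\mathbb{R}^n$. For a list $\tau=(i_1,\dots,i_k)\in\{\pm1,\dots,\pm n\}^k$ write $\tau(x)=(\mathrm{sgn}(i_1)x_{|i_1|},\dots,\mathrm{sgn}(i_k)x_{|i_k|})\in\mathbb{R}^k$ for $x\in\mathbb{R}^n$ and $\tau(C)=\{\tau(x):x\in C\}$ for $C\subseteq\mathbb{R}^n$; the empty list is allowed. For another list $\tau'=(i'_1,\dots,i'_{k'})$, write $\tau\trianglelefteq\tau'$ if $k\le k'$ and $i_j=i'_j$ for all $1\le j\le k$. For a node $v$ of a directed graph, $\delta^+(v)$ is its set of children. Branching tree: a tuple $\mathcal{T}=(V,E,B,\sigma)$ is a $\mathcal{C}$-consistent branching tree if: (T1) $(V,E)$ is an arborescence with $1\le|V|<\infty$ and root $r\in V$. (T2) Each $v\in V$ has a branching constraint $B_v\subseteq\mathbb{R}^n$,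 and $B_r=\mathbb{R}^n$. (T3) For all $u\in V$ with $\delta^+(u)\ne\emptyset$: $\bigcap\mathcal{C}\subseteq\bigcup_{v\in\delta^+(u)}B_v$. (T4) Each $v\in V$ has a list $\sigma_v\in\{\pm1,\dots,\pm n\}^{\ell_v}$, $\ell_v\in\{0,\dots,n\}$, with $|(\sigma_v)_1|,\dots,|(\sigma_v)_{\ell_v}|$ pairwise distinct. (T5) $\sigma_u\trianglelefteq\sigma_v$ for all $u\in V$, $v\in\delta^+(u)$. (T6) For all $v\in V$ and $1\le i\le\ell_v$: $\max\{\sigma_v(x)_i:x\in\bigcap\mathcal{C}\}<\infty$ (i.e. the set is bounded above). (T7) For all $u\in V$ and $v\ne w$ in $\delta^+(u)$: $\sigma_u(B_v)\cap\sigma_u(B_w)=\emptyset$. Relations: for $v\in V$ let $\mathcal{B}_v=\{B_u: u \text{ is a node on the } r\text{-}v\text{-path in } \mathcal{T}\}$. For $x,y\in\bigcap\mathcal{C}$ let $\mathrm{dcn}(x,y)$ be the deepest node $w\in V$ with $x,y\in\bigcap(\mathcal{C}\cup\mathcal{B}_w)$. For $\epsilon>0$ and $a,b\in\mathbb{R}^k$, let $a\succ_\epsilon b$ mean $a\neq b$ and $a_i\ge b_i+\epsilon$ for the smallest index $i$ with $a_i\ne b_i$. For $x,y\in\bigcap\mathcal{C}$ and $v=\mathrm{dcn}(x,y)$: $x\succeq_{\epsilon,\mathcal{T}}y$ iff $\sigma_v(x)=\sigma_v(y)$ or $\sigma_v(x)\succ_\epsilon\sigma_v(y)$; $x\succ_{\epsilon,\mathcal{T}}y$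 iff $\sigma_v(x)\succ_\epsilon\sigma_v(y)$. Configuration: let $F\subseteq\mathbb{R}^n$, $f\colon\mathbb{R}^n\to\mathbb{R}$. A configuration $(\mathcal{C},\mathcal{D},g,z,\mathcal{T},\epsilon)$ with $\mathcal{C},\mathcal{D}\subseteq\mathcal{P}(\mathbb{R}^n)$, $g\colon\mathbb{R}^n\to\mathbb{R}$, $z\in\mathbb{R}\cup\{\infty\}$, $\mathcal{T}$ a branching tree and $\epsilon$ a real number is $(F,f)$-valid if: (V1) $\mathcal{T}$ is $\mathcal{C}$-consistent and $\epsilon>0$. (V2) If $z<\infty$, there exists $x\in F$ with $f(x)\le z$. (V3) For all real $\hat z<z$, there exists $x\in F$ with $f(x)\le\hat z$ if and only if there exists $x\in\bigcap\mathcal{C}$ with $g(x)\le\hat z$. (V4) For every $x\in\bigcap\mathcal{C}$ with $g(x)<z$ there exists $y\in\bigcap(\mathcal{C}\cup\mathcal{D})$ with $y\succeq_{\epsilon,\mathcal{T}}x$ and $g(y)\le g(x)$. *)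

(* Defs.v *)
(* MathComp-Analysis; real numbers are an arbitrary [R : realType], and
   R^n is the type of row vectors ['rV[R]_n]. *)
From HB Require Import structures.
From mathcomp Require Import all_boot all_order all_algebra.
From mathcomp Require Import all_classical all_reals.

Set Implicit Arguments.
Unset Strict Implicit.
Unset Printing Implicit Defensive.

Import Order.TTheory GRing.Theory Num.Theory.
Local Open Scope classical_set_scope.
Local Open Scope ring_scope.

(* [caps set0 = setT], as required by the convention for empty families. *)
Definition caps (T : Type) (C : set (set T)) : set T := \bigcap_(A in C) A.

(* The index i in {+-1, ..., +-n} is encoded as the pair of its sign bit
   ([true] for negative) and |i| - 1. *)
Definition signed_index (n : nat) : Type := (bool * 'I_n)%type.

Definition sproj (R : realType) (n : nat) (tau : seq (signed_index n))
    (x : 'rV[R]_n) : 'rV[R]_(size tau) :=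
  \row_(j < size tau)
    let i := tnth (in_tuple tau) j in (-1) ^+ i.1 * x ord0 i.2.

Definition lex_gt (R : realType) (k : nat) (eps : R) (a b : 'rV[R]_k) : Prop :=
  a <> b /\
  exists i : 'I_k,
    [/\ a ord0 i <> b ord0 i,
        forall j : 'I_k, (j < i)%N -> a ord0 j = b ord0 j
      & b ord0 i + eps <= a ord0 i].

(* Walks from [r] are encoded by the sequence of nodes following [r]. As walks
   may repeat nodes, their uniqueness excludes loops, directed cycles and edges
   into [r]. *)
Definition arborescence (V : finType) (E : rel V) (r : V) : Prop :=
  forall v : V, exists! p : seq V, path E r p /\ last r p = v.

(* The root is recorded explicitly; [arborescence] determines it uniquely. *)
Record branching_tree (R : realType) (n : nat) := BranchingTree {
  node : finType;
  edge : rel node;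
  root : node;
  branch : node -> set 'rV[R]_n;
  sigma : node -> seq (signed_index n) }.

Section Tree.
Context (R : realType) (n : nat).
Implicit Types (C D : set (set 'rV[R]_n)) (T : branching_tree R n).

Definition children T (u : node T) : set (node T) := [set v | edge u v].

(* The nodes after the root on the path from the root to [v]; the default value
   [[::]] is irrelevant for arborescences. *)
Definition root_walk T (v : node T) : seq (node T) :=
  xget [::] [set p | path (@edge _ _ T) (root T) p /\ last (root T) p = v].

Definition root_path T (v : node T) : seq (node T) := root T :: root_walk v.

Definition depth T (v : node T) : nat := size (root_walk v).

Definition branchings T (v : node T) : set (set 'rV[R]_n) :=
  [set branch u | u in [set u | u \in root_path v]].

Record consistent C T : Prop := Consistent {
  tree_arborescence : arborescence (@edge _ _ T) (root T);
  tree_root : branch (root T) = setT;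
  tree_cover : forall u : node T, children u !=set0 ->
    caps C `<=` \bigcup_(v in children u) branch v;
  tree_sigma : forall v : node T,
    (size (sigma v) <= n)%N /\ uniq [seq i.2 | i <- sigma v];
  tree_prefix : forall u v : node T, children u v ->
    prefix (sigma u) (sigma v);
  tree_bounded : forall (v : node T) (i : 'I_(size (sigma v))),
    has_ubound [set sproj (sigma v) x ord0 i | x in caps C];
  tree_disjoint : forall u v w : node T,
    children u v -> children u w -> v <> w ->
    (sproj (sigma u) @` branch v) `&` (sproj (sigma u) @` branch w) = set0 }.

(* For [T] consistent with [C] and x, y in [caps C], the root is a candidate
   (its branching constraint is everything), and the candidates form a path
   starting at the root (sibling constraints are disjoint), so that the deepest
   one is unique. *)
Definition dcn C T (x y : 'rV[R]_n) : node T :=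
  [arg max_(w > root T |
     `[< caps (C `|` branchings w) x /\ caps (C `|` branchings w) y >])
   depth w].

(* Only meaningful for x, y in [caps C]. *)
Definition succeq C T (eps : R) (x y : 'rV[R]_n) : Prop :=
  let v := dcn C T x y in
  sproj (sigma v) x = sproj (sigma v) y \/
  lex_gt eps (sproj (sigma v) x) (sproj (sigma v) y).

Record configuration := Configuration {
  core : set (set 'rV[R]_n);
  derived : set (set 'rV[R]_n);
  obj : 'rV[R]_n -> R;
  bound : \bar R;
  bound_gtNy : (-oo < bound)%E;
  tree : branching_tree R n;
  tol : R }.

Record valid (F : set 'rV[R]_n) (f : 'rV[R]_n -> R) (K : configuration) :
    Prop := Valid {
  valid_tree : consistent (core K) (tree K) /\ 0 < tol K;
  valid_bound : (bound K < +oo)%E ->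
    exists2 x, F x & ((f x)%:E <= bound K)%E;
  valid_obj : forall t : R, (t%:E < bound K)%E ->
    ((exists2 x, F x & f x <= t) <->
     (exists2 x, caps (core K) x & obj K x <= t));
  valid_derived : forall x, caps (core K) x -> ((obj K x)%:E < bound K)%E ->
    exists y, [/\ caps (core K `|` derived K) y,
                  succeq (core K) (tree K) (tol K) y x
                & obj K y <= obj K x] }.

End Tree.

(* Main.v *)
Require Import Defs.
From mathcomp Require Import all_boot all_order all_algebra.
From mathcomp Require Import all_classical all_reals.

Local Open Scope classical_set_scope.
Local Open Scope ring_scope.

(** Validity evaluates the objective only at points of [caps C]: the attainable
    values are those on [caps C], and the dominating points, which satisfy the
    derived constraints as well, lie in the smaller set [caps (C `|` D)].
    Neither the tree conditions nor the dominance relation mentions the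
    objective, so objectives that agree on [caps C] are interchangeable. *)

Theorem theorem5 (R : realType) (n : nat) (F : set 'rV[R]_n)
    (f : 'rV[R]_n -> R) (C D : set (set 'rV[R]_n)) (g : 'rV[R]_n -> R)
    (z : \bar R) (hz : (-oo < z)%E) (T : branching_tree R n) (eps : R)
    (g' : 'rV[R]_n -> R) :
  valid F f (Configuration C D g hz T eps) ->
  caps C `<=` [set x | g' x = g x] ->
  valid F f (Configuration C D g' hz T eps).
Proof.
move=> [/= treeC boundz objE dominated] eq_g; split=> //= [t tz | x Cx].
  rewrite (objE t tz).
  by split=> -[x Cx xt]; exists x => //; move: xt; rewrite (eq_g x Cx).
rewrite (eq_g x Cx) => xz; have [y [CDy yx gyx]] := dominated x Cx xz.
have Cy : caps C y by move=> A CA; apply: CDy; left.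
by exists y; split=> //; rewrite (eq_g y Cy).
Qed.
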